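(* Let $S$ be a t-conorm, $N$ a fuzzy negation, and let $I(x,y)=S(N(x),y)$ for $x,y\in[0,1]$ be the corresponding $(S,N)$-implication. Then in each of the following cases $I$ satisfies $I(I(y,x),I(x,y))=I(x,y)$ for all $x,y\in[0,1]$: (i) $S=\max$; (ii) $S=S_D$, the drastic t-conorm; (iii) the pair $(S,N)$ satisfies $S(N(x),x)=1$ for all $x\in[0,1]$.
   Context: A t-conorm is a function $S\colon[0,1]^2\to[0,1]$ that is commutative, associative, non-decreasing in each variable, and satisfies $S(x,0)=x$ for all $x$. A fuzzy negation is a non-increasing function $N\colon[0,1]\to[0,1]$ with $N(0)=1$ and $N(1)=0$. The drastic t-conorm $S_D$ is given by $S_D(x,y)=y$ if $x=0$, $S_D(x,y)=x$ if $y=0$, and $S_D(x,y)=1$ otherwise. *)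

(* Defs.v *)
From mathcomp Require Import all_boot all_order all_algebra reals.

Set Implicit Arguments.
Unset Strict Implicit.
Unset Printing Implicit Defensive.

Import Order.TTheory GRing.Theory Num.Theory.
Local Open Scope ring_scope.

(* Operations on [0,1] are represented by total functions on R; only their
   values at points of [0,1] are constrained or used, and their values there
   are required to lie in [0,1]. *)
Definition I01 {R : realType} : interval R := `[0, 1].

Record is_tconorm (R : realType) (S : R -> R -> R) : Prop := IsTconorm {
  tconorm_stable : {in I01 &, forall x y, S x y \in I01};
  tconormC : {in I01 &, forall x y, S x y = S y x};
  tconormA : {in I01 & &, forall x y z, S x (S y z) = S (S x y) z};
  tconorm_homo_l : {in I01, forall y, {in I01 &, {homo S^~ y : x x' / x <= x'}}};
  tconorm_homo_r : {in I01, forall x, {in I01 &, {homo S x : y y' / y <= y'}}};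
  tconormx0 : {in I01, forall x, S x 0 = x}
}.

Record is_fuzzy_negation (R : realType) (N : R -> R) : Prop := IsFuzzyNegation {
  fuzzy_negation_stable : {in I01, forall x, N x \in I01};
  fuzzy_negation_nhomo : {in I01 &, {homo N : x y /~ x <= y}};
  fuzzy_negation0 : N 0 = 1;
  fuzzy_negation1 : N 1 = 0
}.

Definition drastic_tconorm (R : realType) (x y : R) : R :=
  if x == 0 then y else if y == 0 then x else 1.

Definition sn_implication (R : realType) (S : R -> R -> R) (N : R -> R)
  (x y : R) : R := S (N x) y.

(* Main.v *)
(* Put a = N (I y x) and b = I x y.  Since 0 is neutral and 1 is absorbing for
   S, the equation S a b = b holds as soon as a = 0 or b = 1; this dichotomy
   settles the drastic case (split on N x = 0 and y = 0) and the case
   S (N x) x = 1 (split on x <= y).  For S = max it follows from a <= N x <= b,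
   a consequence of x <= I y x. *)
Require Import Defs.
From mathcomp Require Import all_boot all_order all_algebra reals.

Import Order.TTheory GRing.Theory Num.Theory.
Local Open Scope ring_scope.

Lemma I01_0 (R : realType) : (0 : R) \in I01.
Proof. by rewrite in_itv /= lexx ler01. Qed.

Lemma I01_1 (R : realType) : (1 : R) \in I01.
Proof. by rewrite in_itv /= lexx ler01. Qed.

Lemma I01_ge0 (R : realType) (x : R) : x \in I01 -> 0 <= x.
Proof. by rewrite in_itv => /andP[]. Qed.

Lemma I01_le1 (R : realType) (x : R) : x \in I01 -> x <= 1.
Proof. by rewrite in_itv => /andP[]. Qed.

Local Hint Extern 0 (is_true (_ \in I01)) =>
  solve [apply: I01_0 | apply: I01_1] : core.

Section Tconorm.
Variables (R : realType) (S : R -> R -> R).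
Hypothesis hS : is_tconorm S.

Lemma tconorm0x (x : R) : x \in I01 -> S 0 x = x.
Proof. by move=> hx; rewrite (tconormC hS) // (tconormx0 hS). Qed.

(** Monotonicity in the second argument, applied to [0 <= y], with [x] read as [S x 0]. *)
Lemma tconorm_ge_l (x y : R) : x \in I01 -> y \in I01 -> x <= S x y.
Proof.
move=> hx hy; rewrite -{1}(tconormx0 hS hx).
by apply: (tconorm_homo_r hS) => //; exact: I01_ge0.
Qed.

Lemma tconorm_ge_r (x y : R) : x \in I01 -> y \in I01 -> y <= S x y.
Proof. by move=> hx hy; rewrite (tconormC hS) // tconorm_ge_l. Qed.

(** Squeeze: [1 <= S 1 x] by [tconorm_ge_l], while values of [S] stay below 1. *)
Lemma tconorm1x (x : R) : x \in I01 -> S 1 x = 1.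
Proof.
move=> hx; apply: le_anti; rewrite tconorm_ge_l // andbT.
by apply: I01_le1; exact: (tconorm_stable hS).
Qed.

Lemma tconormx1 (x : R) : x \in I01 -> S x 1 = 1.
Proof. by move=> hx; rewrite (tconormC hS) // tconorm1x. Qed.

End Tconorm.

Theorem theorem2p5 (R : realType) (S : R -> R -> R) (N : R -> R)
    (hS : is_tconorm S) (hN : is_fuzzy_negation N) :
  let I := sn_implication S N in
  [\/ {in I01 &, forall x y, S x y = Num.max x y},
      {in I01 &, forall x y, S x y = drastic_tconorm x y}
    | {in I01, forall x, S (N x) x = 1}] ->
  {in I01 &, forall x y, I (I y x) (I x y) = I x y}.
Proof.
move=> I hI x y hx hy.
have hNx : N x \in I01 by exact: (fuzzy_negation_stable hN).
have hNy : N y \in I01 by exact: (fuzzy_negation_stable hN).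
have hIxy : I x y \in I01 by exact: (tconorm_stable hS).
have hIyx : I y x \in I01 by exact: (tconorm_stable hS).
have hNI : N (I y x) \in I01 by exact: (fuzzy_negation_stable hN).
have dichotomy : N (I y x) = 0 \/ I x y = 1 -> I (I y x) (I x y) = I x y.
  (* Only the outer [I] is unfolded, so the inner [I y x] and [I x y] still match the case
     hypotheses. *)
  rewrite -[I (I y x) _]/(S (N (I y x)) (I x y)).
  by case=> ->; rewrite ?(tconorm0x _ _ hS) ?(tconormx1 _ _ hS).
case: hI => [Smax | Sdrastic | Sexcl].
- rewrite [LHS]Smax //; apply/max_idPr.
  apply: (@le_trans _ _ (N x)); last exact: (tconorm_ge_l _ _ hS).
  by apply: (fuzzy_negation_nhomo hN) => //; exact: (tconorm_ge_r _ _ hS).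
- apply: dichotomy; case: (eqVneq y 0) => [y0 | y_neq0].
    (* Here [I y x = S (N 0) x = S 1 x = 1], which [N] sends to 0. *)
    left; rewrite y0 /I /sn_implication (fuzzy_negation0 hN).
    by rewrite (tconorm1x _ _ hS) // (fuzzy_negation1 hN).
  case: (eqVneq (N x) 0) => [Nx0 | Nx_neq0].
    (* From [x <= I y x], antitonicity gives [N (I y x) <= N x = 0]. *)
    left; apply: le_anti; rewrite (I01_ge0 _ _ hNI) andbT -Nx0.
    by apply: (fuzzy_negation_nhomo hN) => //; exact: (tconorm_ge_r _ _ hS).
  by right; rewrite /I /sn_implication Sdrastic // /drastic_tconorm
    (negbTE Nx_neq0) (negbTE y_neq0).
- apply: dichotomy; case: (leP x y) => [le_xy | /ltW le_yx].
    (* Monotonicity: [1 = S (N x) x <= S (N x) y = I x y]. *)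
    right; apply: le_anti; rewrite (I01_le1 _ _ hIxy) /= -(Sexcl x hx).
    exact: (tconorm_homo_r hS).
  (* It suffices that [I y x = 1], and [1 = S (N y) y <= S (N y) x]. *)
  left; rewrite -(fuzzy_negation1 hN); congr N.
  apply: le_anti; rewrite (I01_le1 _ _ hIyx) /= -(Sexcl y hy).
  exact: (tconorm_homo_r hS).
Qed.
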